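(* Let $A$, $S(0)$ be $n\times n$ matrices and $\Pi(0)=\begin{bmatrix}\vartheta_1&\vartheta_2\end{bmatrix}$ an $n\times m$ matrix (with $\vartheta_i$ of size $n\times m_i$) such that $S(0)>0$, $\det A\ne0$ and $$AS(0)-S(0)A^*=\mathrm{i}\,\Pi(0)\,j\,\Pi(0)^*.$$ Introduce, for $x\ge0$, the matrix functions $$\Pi(x)=\begin{bmatrix}\mathrm{e}^{-\mathrm{i}xA}\vartheta_1&\mathrm{e}^{\mathrm{i}xA}\vartheta_2\end{bmatrix},\qquad S(x)=S(0)+\int_0^x\Pi(\xi)\Pi(\xi)^*\,d\xi,$$ $$u(x)=\big(I_m-\mathrm{i}j\Pi(x)^*S(x)^{-1}A^{-1}\Pi(x)\big)\big(I_m+\mathrm{i}j\Pi(0)^*(A^{-1})^*S(0)^{-1}\Pi(0)\big).$$ Then the matrix functions $$Y(x,t)=u(x)^*j\Pi(x)^*S(x)^{-1}\mathrm{e}^{\mathrm{i}tA},\qquad \mathcal H(x)=u(x)^{-1}\big(u(x)^*\big)^{-1}$$ satisfy the dynamical canonical system $$\frac{\partial}{\partial t}Y(x,t)=j\frac{\partial}{\partial x}\Big(\mathcal H(x)Y(x,t)\Big),\qquad \mathcal H(x)>0.$$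
   Context: All matrices are complex; $n\in\mathbb N$; $m_1>0$, $m_2>0$, $m=m_1+m_2$; $I_p$ is the $p\times p$ identity matrix; $j=\begin{bmatrix} I_{m_1}&0\\0&-I_{m_2}\end{bmatrix}$. $M^*$ is the conjugate transpose of $M$, and $M>0$ means $M$ is Hermitian positive definite. Since $S(0)>0$, the matrices $S(x)$, $x\ge0$, are positive definite, hence invertible. *)

(* Defs.v *)
From mathcomp Require Import all_boot all_order all_algebra.
From mathcomp Require Import complex.
From mathcomp Require Import all_classical all_reals all_analysis.

Set Implicit Arguments.
Unset Strict Implicit.
Unset Printing Implicit Defensive.

Import Order.TTheory GRing.Theory Num.Theory.
Import numFieldNormedType.Exports.

Local Open Scope classical_set_scope.
Local Open Scope ring_scope.
Local Open Scope complex_scope.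
Local Open Scope sesquilinear_scope.

(* R[i] has no structure of normed module over R in the libraries, so limits,
   derivatives in a real variable and integrals of complex matrices are taken on
   the real and imaginary parts of each entry. *)

Section ComplexMatrixCalculus.
Variable R : realType.

Definition mxlim (p q : nat) (F : nat -> 'M[R[i]]_(p, q)) : 'M[R[i]]_(p, q) :=
  \matrix_(i, j) (limn (fun k => complex.Re (F k i j))
                  +i* limn (fun k => complex.Im (F k i j))).

Definition mxexp (n : nat) (A : 'M[R[i]]_n) : 'M[R[i]]_n :=
  mxlim (fun N => \sum_(k < N) (k`!%:R)^-1 *: A ^+ k).

Definition mxintegral (p q : nat) (D : set R) (F : R -> 'M[R[i]]_(p, q)) :
    'M[R[i]]_(p, q) :=
  \matrix_(i, j) (Rintegral lebesgue_measure D (fun s => complex.Re (F s i j))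
                  +i* Rintegral lebesgue_measure D (fun s => complex.Im (F s i j))).

(* [f] is differentiable at [x] relatively to [D], with derivative [l]: the usual
   two-sided derivative if [D] is a neighborhood of [x], and the right derivative
   if [D] is the half-line `[x, +oo[. *)
Definition is_derive_in (D : set R) (f : R -> R) (x l : R) : Prop :=
  (f y - f x) / (y - x) @[y --> within D x^'] --> l.

Definition is_mxderive_in (p q : nat) (D : set R) (F : R -> 'M[R[i]]_(p, q))
    (x : R) (L : 'M[R[i]]_(p, q)) : Prop :=
  forall i j,
    is_derive_in D (fun y => complex.Re (F y i j)) x (complex.Re (L i j)) /\
    is_derive_in D (fun y => complex.Im (F y i j)) x (complex.Im (L i j)).

End ComplexMatrixCalculus.

Definition posdefmx (R : realType) (p : nat) (M : 'M[R[i]]_p) : Prop :=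
  M \is hermsymmx /\
  forall v : 'cV[R[i]]_p, v != 0 -> 0 < (v ^t* *m M *m v) 0 0.

Definition jmx (R : realType) (m1 m2 : nat) : 'M[R[i]]_(m1 + m2) :=
  block_mx 1%:M 0 0 (- 1%:M).

Section DynamicalCanonicalSystem.
Variables (R : realType) (n m1 m2 : nat) (A S0 : 'M[R[i]]_n).
Variables (th1 : 'M[R[i]]_(n, m1)) (th2 : 'M[R[i]]_(n, m2)).

Let j := jmx R m1 m2.

Definition PiF (x : R) : 'M[R[i]]_(n, m1 + m2) :=
  row_mx (mxexp (- ('i * x%:C) *: A) *m th1) (mxexp (('i * x%:C) *: A) *m th2).

Definition SF (x : R) : 'M[R[i]]_n :=
  S0 + mxintegral `[0, x] (fun s => PiF s *m (PiF s) ^t*).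

Definition uF (x : R) : 'M[R[i]]_(m1 + m2) :=
  (1%:M - 'i *: (j *m (PiF x) ^t* *m invmx (SF x) *m invmx A *m PiF x)) *m
  (1%:M + 'i *: (j *m (row_mx th1 th2) ^t* *m (invmx A) ^t* *m invmx S0
                 *m row_mx th1 th2)).

Definition YF (x t : R) : 'M[R[i]]_(m1 + m2, n) :=
  (uF x) ^t* *m j *m (PiF x) ^t* *m invmx (SF x) *m mxexp (('i * t%:C) *: A).

(* [invmx] is the identity on singular matrices, but the positive definiteness of
   [HF x] forces [uF x] to be invertible: otherwise [HF x] would be the singular
   matrix [uF x *m (uF x) ^t*]. *)
Definition HF (x : R) : 'M[R[i]]_(m1 + m2) :=
  invmx (uF x) *m invmx ((uF x) ^t*).

End DynamicalCanonicalSystem.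

(* Main.v *)
(* Write M^H for the conjugate transpose, j = jmx, Pi = Pi(x), S = S(x), and
     V = 1 - i j Pi^H S^-1 A^-1 Pi,   W = 1 + i j Pi^H A^-H S^-1 Pi.
   The identity A S - S A^H = i Pi j Pi^H propagates from 0 to every x >= 0,
   since Pi' = - i A Pi j and S' = Pi Pi^H.  It gives V W = 1, hence
   u(x) = V(x) W(0) has the inverse V(0) W(x), and also
   W j Pi^H S^-1 = j Pi^H A^-H S^-1 A.  Therefore
     H(x) Y(x,t) = V(0) j Pi^H A^-H S^-1 A exp(i t A),
   so that u itself never has to be differentiated: the x-derivative of the
   right-hand side is computed from Pi' and (S^-1)' = - S^-1 Pi Pi^H S^-1, and
   W(0)^H = j V(0) j identifies it with j times the t-derivative of Y. *)

Require Import Defs.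
From mathcomp Require Import all_boot all_order all_algebra.
From mathcomp Require Import complex.
From mathcomp Require Import all_classical all_reals all_analysis.

Import Order.TTheory GRing.Theory Num.Theory.
Import numFieldNormedType.Exports.
Import ComplexField.Normc.

Local Open Scope classical_set_scope.
Local Open Scope ring_scope.
Local Open Scope complex_scope.
Local Open Scope sesquilinear_scope.

Set Implicit Arguments.
Unset Strict Implicit.
Unset Printing Implicit Defensive.

(** * Limits of complex matrices *)

(** The filter is left arbitrary so that the same rules serve [\oo] for the exponential series,
    [within D x^'] for difference quotients and [nbhs x] for continuity. *)
Definition ccvg {R : realType} {T : Type} (F : set_system T)
    (f : T -> R[i]) (l : R[i]) : Prop :=
  (fun y => complex.Re (f y)) @ F --> complex.Re l /\
  (fun y => complex.Im (f y)) @ F --> complex.Im l.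

Definition mcvg {R : realType} {T : Type} (F : set_system T) {p q : nat}
    (f : T -> 'M[R[i]]_(p, q)) (L : 'M[R[i]]_(p, q)) : Prop :=
  forall i j, ccvg F (fun y => f y i j) (L i j).

Section RealImaginaryParts.
Context {R : realType}.
Implicit Types (z w : R[i]) (r : R).

Lemma ReD z w : complex.Re (z + w) = complex.Re z + complex.Re w.
Proof. by case: z w => [? ?] []. Qed.

Lemma ImD z w : complex.Im (z + w) = complex.Im z + complex.Im w.
Proof. by case: z w => [? ?] []. Qed.

Lemma ReM z w : complex.Re (z * w) =
  complex.Re z * complex.Re w - complex.Im z * complex.Im w.
Proof. by case: z w => [? ?] []. Qed.

Lemma ImM z w : complex.Im (z * w) =
  complex.Re z * complex.Im w + complex.Im z * complex.Re w.
Proof. by case: z w => [? ?] []. Qed.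

Lemma ReZ r z : complex.Re (r%:C * z) = r * complex.Re z.
Proof. by rewrite ReM mul0r subr0. Qed.

Lemma ImZ r z : complex.Im (r%:C * z) = r * complex.Im z.
Proof. by rewrite ImM mul0r addr0. Qed.

Lemma normRe_le z : `|complex.Re z| <= normc z.
Proof. by case: z => a b /=; rewrite -sqrtr_sqr ler_wsqrtr// lerDl sqr_ge0. Qed.

Lemma normIm_le z : `|complex.Im z| <= normc z.
Proof. by case: z => a b /=; rewrite -sqrtr_sqr ler_wsqrtr// lerDr sqr_ge0. Qed.

End RealImaginaryParts.

Section ComplexLimits.
Context {R : realType} {T : Type} {F : set_system T} {FF : Filter F}.
Implicit Types (f g : T -> R[i]) (l k : R[i]).

Lemma ccvg_cst l : ccvg F (fun _ => l) l.
Proof. by split; exact: cvg_cst. Qed.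

Lemma ccvg_near f g l : {near F, f =1 g} -> ccvg F f l -> ccvg F g l.
Proof.
move=> fg [fr fi]; split.
- by apply: cvg_trans fr; apply: near_eq_cvg; near=> y; rewrite (near fg y).
- by apply: cvg_trans fi; apply: near_eq_cvg; near=> y; rewrite (near fg y).
Unshelve. all: by end_near. Qed.

Lemma ccvgD f g l k : ccvg F f l -> ccvg F g k ->
  ccvg F (fun y => f y + g y) (l + k).
Proof.
move=> [fr fi] [gr gi]; split.
- by rewrite ReD; under eq_fun do rewrite ReD; exact: cvgD.
- by rewrite ImD; under eq_fun do rewrite ImD; exact: cvgD.
Qed.

Lemma ccvgM f g l k : ccvg F f l -> ccvg F g k ->
  ccvg F (fun y => f y * g y) (l * k).
Proof.
move=> [fr fi] [gr gi]; split.
- rewrite ReM; under eq_fun do rewrite ReM.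
  by apply: cvgB; exact: cvgM.
- rewrite ImM; under eq_fun do rewrite ImM.
  by apply: cvgD; exact: cvgM.
Qed.

Lemma ccvg_conj f l : ccvg F f l ->
  ccvg F (fun y => Num.conj (f y)) (Num.conj l).
Proof.
move=> [fr fi]; split.
- have ReJ (z : R[i]) : complex.Re (Num.conj z) = complex.Re z by case: z.
  by rewrite ReJ; under eq_fun do rewrite ReJ.
- have ImJ (z : R[i]) : complex.Im (Num.conj z) = - complex.Im z by case: z.
  by rewrite ImJ; under eq_fun do rewrite ImJ; exact: cvgN.
Qed.

Lemma ccvg_real (f : T -> R) (l : R) :
  f @ F --> l -> ccvg F (fun y => (f y)%:C) l%:C.
Proof. by move=> fl; split => //=; exact: cvg_cst. Qed.

Lemma ccvgV f l : l != 0 -> ccvg F f l -> ccvg F (fun y => (f y)^-1) l^-1.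
Proof.
(* The formula 1/z = conj(z) / |z|^2 reduces complex inversion to inversion in [R]. *)
have VE (z : R[i]) :
    z^-1 = ((complex.Re z ^+ 2 + complex.Im z ^+ 2)^-1)%:C * Num.conj z.
  by rewrite fmorphV /= add_Re2_Im2 invc_norm.
move=> l0 fl; rewrite VE; under eq_fun do rewrite VE.
apply: ccvgM; last exact: ccvg_conj.
apply: ccvg_real; apply: cvgV.
  by rewrite -(inj_eq (@complexI R)) add_Re2_Im2 expf_eq0/= normr_eq0.
by apply: cvgD; apply: cvgM; (exact: fl.1 || exact: fl.2).
Qed.

Lemma ccvg_neq0 f l : l != 0 -> ccvg F f l -> \forall y \near F, f y != 0.
Proof.
rewrite eq_complex negb_and => /orP[] l0 [fr fi].
- near=> y; rewrite eq_complex negb_and; apply/orP; left.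
  by near: y; exact: cvgr_neq0 fr _.
- near=> y; rewrite eq_complex negb_and; apply/orP; right.
  by near: y; exact: cvgr_neq0 fi _.
Unshelve. all: by end_near. Qed.

Lemma ccvg_sum (I : Type) (r : seq I) (P : pred I) (f : I -> T -> R[i])
    (l : I -> R[i]) : (forall i, P i -> ccvg F (f i) (l i)) ->
  ccvg F (fun y => \sum_(i <- r | P i) f i y) (\sum_(i <- r | P i) l i).
Proof.
move=> fl; elim: r => [|i r IH].
  by rewrite big_nil; under eq_fun do rewrite big_nil; exact: ccvg_cst.
rewrite big_cons; under eq_fun do rewrite big_cons.
by case: ifPn => // Pi; apply: ccvgD => //; exact: fl.
Qed.

Lemma ccvg_prod (I : Type) (r : seq I) (P : pred I) (f : I -> T -> R[i])
    (l : I -> R[i]) : (forall i, P i -> ccvg F (f i) (l i)) ->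
  ccvg F (fun y => \prod_(i <- r | P i) f i y) (\prod_(i <- r | P i) l i).
Proof.
move=> fl; elim: r => [|i r IH].
  by rewrite big_nil; under eq_fun do rewrite big_nil; exact: ccvg_cst.
rewrite big_cons; under eq_fun do rewrite big_cons.
by case: ifPn => // Pi; apply: ccvgM => //; exact: fl.
Qed.

End ComplexLimits.

Lemma ccvg_unique {R : realType} {T : Type} {F : set_system T}
    {FF : ProperFilter F} (f : T -> R[i]) (l k : R[i]) :
  ccvg F f l -> ccvg F f k -> l = k.
Proof.
move=> [fr fi] [gr gi]; apply/eqP; rewrite eq_complex; apply/andP; split.
- by apply/eqP; exact: (cvg_unique _ fr gr).
- by apply/eqP; exact: (cvg_unique _ fi gi).
Qed.

Section MatrixLimits.
Context {R : realType} {T : Type} {F : set_system T} {FF : Filter F}.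

Lemma mcvg_cst (p q : nat) (L : 'M[R[i]]_(p, q)) : mcvg F (fun _ => L) L.
Proof. by move=> i j; exact: ccvg_cst. Qed.

Lemma mcvg_near (p q : nat) (f g : T -> 'M[R[i]]_(p, q)) L :
  {near F, f =1 g} -> mcvg F f L -> mcvg F g L.
Proof.
move=> fg fL i j; apply: ccvg_near (fL i j).
by near=> y; rewrite (near fg y).
Unshelve. all: by end_near. Qed.

Lemma mcvgD (p q : nat) (f g : T -> 'M[R[i]]_(p, q)) L K :
  mcvg F f L -> mcvg F g K -> mcvg F (fun y => f y + g y) (L + K).
Proof.
move=> fL gK i j; rewrite mxE; under eq_fun do rewrite mxE.
exact: ccvgD (fL i j) (gK i j).
Qed.

Lemma mcvgM (p q r : nat) (f : T -> 'M[R[i]]_(p, q))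
    (g : T -> 'M[R[i]]_(q, r)) L K :
  mcvg F f L -> mcvg F g K -> mcvg F (fun y => f y *m g y) (L *m K).
Proof.
move=> fL gK i j; rewrite mxE; under eq_fun do rewrite mxE.
by apply: ccvg_sum => k _; exact: ccvgM (fL i k) (gK k j).
Qed.

Lemma mcvgZ (p q : nat) (c : T -> R[i]) (f : T -> 'M[R[i]]_(p, q)) d L :
  ccvg F c d -> mcvg F f L -> mcvg F (fun y => c y *: f y) (d *: L).
Proof.
move=> cd fL i j; rewrite mxE; under eq_fun do rewrite mxE.
exact: ccvgM cd (fL i j).
Qed.

Lemma mcvg_trC (p q : nat) (f : T -> 'M[R[i]]_(p, q)) L :
  mcvg F f L -> mcvg F (fun y => (f y) ^t*) (L ^t*).
Proof.
move=> fL i j; rewrite !mxE; under eq_fun do rewrite !mxE.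
exact: ccvg_conj (fL j i).
Qed.

Lemma mcvg_row_mx (p q r : nat) (f : T -> 'M[R[i]]_(p, q))
    (g : T -> 'M[R[i]]_(p, r)) L K :
  mcvg F f L -> mcvg F g K -> mcvg F (fun y => row_mx (f y) (g y)) (row_mx L K).
Proof.
move=> fL gK i j; rewrite mxE; under eq_fun do rewrite mxE.
by case: fintype.split => k; [exact: fL|exact: gK].
Qed.

Lemma ccvg_det (n : nat) (f : T -> 'M[R[i]]_n) L :
  mcvg F f L -> ccvg F (fun y => \det (f y)) (\det L).
Proof.
move=> fL; apply: ccvg_sum => s _; apply: ccvgM; first exact: ccvg_cst.
by apply: ccvg_prod => i _; exact: fL.
Qed.

Lemma mcvg_adj (n : nat) (f : T -> 'M[R[i]]_n) L :
  mcvg F f L -> mcvg F (fun y => \adj (f y)) (\adj L).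
Proof.
move=> fL i j; rewrite mxE; under eq_fun do rewrite mxE.
apply: ccvgM; first exact: ccvg_cst.
apply: ccvg_det => a b; rewrite !mxE; under eq_fun do rewrite !mxE.
exact: fL.
Qed.

(** By Cramer's rule the inverse is the adjugate over the determinant, and both are polynomial in
    the entries. The formula only holds near the limit, where the determinant stays nonzero: [invmx]
    returns a singular matrix unchanged. *)
Lemma mcvg_invmx (n : nat) (f : T -> 'M[R[i]]_n) L :
  L \in unitmx -> mcvg F f L -> mcvg F (fun y => invmx (f y)) (invmx L).
Proof.
move=> LU fL; have dL0 : \det L != 0 by move: LU; rewrite unitmxE unitfE.
have dfL := ccvg_det fL.
apply: (@mcvg_near _ _ (fun y => (\det (f y))^-1 *: \adj (f y))).
  near=> y; rewrite /invmx ifT// unitmxE unitfE.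
  by near: y; exact: ccvg_neq0 dfL.
rewrite /invmx LU.
by apply: mcvgZ; [exact: ccvgV|exact: mcvg_adj].
Unshelve. all: by end_near. Qed.

End MatrixLimits.

Lemma mcvg_unique {R : realType} {T : Type} {F : set_system T}
    {FF : ProperFilter F} (p q : nat) (f : T -> 'M[R[i]]_(p, q)) L K :
  mcvg F f L -> mcvg F f K -> L = K.
Proof.
by move=> fL fK; apply/matrixP => i j; exact: ccvg_unique (fL i j) (fK i j).
Qed.

(** * Derivatives of complex matrices *)

(** Replaces the entrywise definition by a single matrix difference quotient, to which the rules for
    matrix limits apply. *)
Lemma is_mxderive_inE (R : realType) (p q : nat) (D : set R)
    (F : R -> 'M[R[i]]_(p, q)) (x : R) (L : 'M[R[i]]_(p, q)) :
  is_mxderive_in D F x L <->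
  mcvg (within D x^') (fun y => ((y - x)^-1)%:C *: (F y - F x)) L.
Proof.
have ReE (r : R) (a b : R[i]) :
    complex.Re (r%:C * (a - b)) = (complex.Re a - complex.Re b) * r.
  by rewrite ReZ mulrC; case: a b => [? ?] [].
have ImE (r : R) (a b : R[i]) :
    complex.Im (r%:C * (a - b)) = (complex.Im a - complex.Im b) * r.
  by rewrite ImZ mulrC; case: a b => [? ?] [].
split=> FL i j; have [fr fi] := FL i j.
- split; under eq_fun do rewrite !mxE.
  + by under eq_fun do rewrite ReE.
  + by under eq_fun do rewrite ImE.
- move: fr fi; under eq_fun do rewrite !mxE ReE.
  by under [X in (X @ _ --> complex.Im _) -> _]eq_fun do rewrite !mxE ImE.
Qed.

Section MatrixDerivatives.
Context {R : realType} {D : set R}.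
Implicit Types x : R.

Lemma is_mxderive_sub (E : set R) (p q : nat) (F : R -> 'M[R[i]]_(p, q)) x L :
  E `<=` D -> is_mxderive_in D F x L -> is_mxderive_in E F x L.
Proof.
move=> ED FL i j; have [fr fi] := FL i j.
by split; [apply: cvg_trans fr|apply: cvg_trans fi];
  apply: cvg_app; apply: within_subset; exact: ED.
Qed.

Lemma is_mxderive_congr (p q : nat) (F G : R -> 'M[R[i]]_(p, q)) x L :
  D x -> (forall y, D y -> F y = G y) ->
  is_mxderive_in D F x L -> is_mxderive_in D G x L.
Proof.
move=> Dx FG /is_mxderive_inE FL; apply/is_mxderive_inE.
apply: mcvg_near FL; rewrite /prop_near1 /nbhs /= /within /=.
by apply: nearW => y Dy; rewrite FG// FG.
Qed.

Lemma is_mxderive_cvg (p q : nat) (F : R -> 'M[R[i]]_(p, q)) x L :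
  is_mxderive_in D F x L -> mcvg (within D x^') F (F x).
Proof.
move=> /is_mxderive_inE FL.
(* [F y] is [F x] plus [y - x] times the difference quotient, whose limit [L] is multiplied by 0. *)
have <- : F x + (x - x)%:C *: L = F x by rewrite subrr scale0r addr0.
apply: (@mcvg_near _ _ _ _ _ _
  (fun y => F x + (y - x)%:C *: (((y - x)^-1)%:C *: (F y - F x)))).
  apply: nearW => y; have [->|yx] := eqVneq y x.
    by rewrite !subrr !scaler0 addr0.
  by rewrite scalerA -rmorphM /= mulfV ?subr_eq0// scale1r addrC subrK.
apply: mcvgD; first exact: mcvg_cst.
apply: mcvgZ => //; apply: ccvg_real.
have Dxx : within D x^' --> x.
  by apply: (@cvg_trans _ (x^')); exact: cvg_within.
by apply: cvgB; [exact: Dxx|exact: cvg_cst].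
Qed.

Lemma is_mxderive_cst (p q : nat) (L : 'M[R[i]]_(p, q)) x :
  is_mxderive_in D (fun _ => L) x 0.
Proof.
apply/is_mxderive_inE; under eq_fun do rewrite subrr scaler0.
exact: mcvg_cst.
Qed.

Lemma is_mxderiveD (p q : nat) (F G : R -> 'M[R[i]]_(p, q)) x L K :
  is_mxderive_in D F x L -> is_mxderive_in D G x K ->
  is_mxderive_in D (fun y => F y + G y) x (L + K).
Proof.
move=> /is_mxderive_inE FL /is_mxderive_inE GK; apply/is_mxderive_inE.
under eq_fun do rewrite opprD addrACA scalerDr.
exact: mcvgD.
Qed.

Lemma is_mxderiveM (p q r : nat) (F : R -> 'M[R[i]]_(p, q))
    (G : R -> 'M[R[i]]_(q, r)) x L K :
  is_mxderive_in D F x L -> is_mxderive_in D G x K ->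
  is_mxderive_in D (fun y => F y *m G y) x (L *m G x + F x *m K).
Proof.
move=> FL GK; have Fx := is_mxderive_cvg FL.
move/is_mxderive_inE : FL => FL; move/is_mxderive_inE : GK => GK.
apply/is_mxderive_inE.
(* The factor order is kept. The second term carries [F y] instead of [F x], hence the continuity
   fact [Fx]. *)
have -> : (fun y => ((y - x)^-1)%:C *: (F y *m G y - F x *m G x)) =
    (fun y => (((y - x)^-1)%:C *: (F y - F x)) *m G x +
              F y *m (((y - x)^-1)%:C *: (G y - G x))).
  apply/funext => y; rewrite -scalemxAl -scalemxAr -scalerDr mulmxBl mulmxBr.
  by congr (_ *: _); rewrite [RHS]addrC addrA subrK.
by apply: mcvgD; apply: mcvgM => //; exact: mcvg_cst.
Qed.

Lemma is_mxderiveMl (p q r : nat) (C : 'M[R[i]]_(p, q))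
    (G : R -> 'M[R[i]]_(q, r)) x K :
  is_mxderive_in D G x K -> is_mxderive_in D (fun y => C *m G y) x (C *m K).
Proof.
move=> /(is_mxderiveM (is_mxderive_cst C x)).
by rewrite mul0mx add0r.
Qed.

Lemma is_mxderiveMr (p q r : nat) (F : R -> 'M[R[i]]_(p, q))
    (C : 'M[R[i]]_(q, r)) x L :
  is_mxderive_in D F x L -> is_mxderive_in D (fun y => F y *m C) x (L *m C).
Proof.
move=> /is_mxderiveM /(_ (is_mxderive_cst C x)).
by rewrite mulmx0 addr0.
Qed.

Lemma is_mxderiveZ (p q : nat) (c : R[i]) (F : R -> 'M[R[i]]_(p, q)) x L :
  is_mxderive_in D F x L -> is_mxderive_in D (fun y => c *: F y) x (c *: L).
Proof.
move=> /(is_mxderiveMl c%:M); rewrite mul_scalar_mx.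
by under eq_fun do rewrite mul_scalar_mx.
Qed.

Lemma is_mxderiveB (p q : nat) (F G : R -> 'M[R[i]]_(p, q)) x L K :
  is_mxderive_in D F x L -> is_mxderive_in D G x K ->
  is_mxderive_in D (fun y => F y - G y) x (L - K).
Proof.
move=> FL /(is_mxderiveZ (-1)) GK; rewrite -scaleN1r.
under eq_fun do rewrite -scaleN1r.
exact: is_mxderiveD.
Qed.

Lemma is_mxderive_trC (p q : nat) (F : R -> 'M[R[i]]_(p, q)) x L :
  is_mxderive_in D F x L -> is_mxderive_in D (fun y => (F y) ^t*) x (L ^t*).
Proof.
move=> /is_mxderive_inE /mcvg_trC FL; apply/is_mxderive_inE.
apply: mcvg_near FL; apply: nearW => y.
apply/matrixP => i j; rewrite !mxE rmorphM rmorphB /=.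
(* The factor 1/(y - x) is real, so conjugation fixes it. *)
by congr (_ * _); exact: conjc_real.
Qed.

Lemma is_mxderive_row_mx (p q r : nat) (F : R -> 'M[R[i]]_(p, q))
    (G : R -> 'M[R[i]]_(p, r)) x L K :
  is_mxderive_in D F x L -> is_mxderive_in D G x K ->
  is_mxderive_in D (fun y => row_mx (F y) (G y)) x (row_mx L K).
Proof.
move=> /is_mxderive_inE FL /is_mxderive_inE GK; apply/is_mxderive_inE.
under eq_fun do rewrite opp_row_mx add_row_mx scale_row_mx.
exact: mcvg_row_mx.
Qed.

(** Rests on F(y)^-1 - F(x)^-1 = - F(y)^-1 (F(y) - F(x)) F(x)^-1 and on the continuity of the
    inverse at [F x]. *)
Lemma is_mxderive_invmx (n : nat) (F : R -> 'M[R[i]]_n) x L :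
  D x -> (forall y, D y -> F y \in unitmx) ->
  is_mxderive_in D F x L ->
  is_mxderive_in D (fun y => invmx (F y)) x
    (- (invmx (F x) *m L *m invmx (F x))).
Proof.
move=> Dx FU FL; have /(mcvg_invmx (FU _ Dx)) Fx := is_mxderive_cvg FL.
move/is_mxderive_inE : FL => FL; apply/is_mxderive_inE.
rewrite -[- (_ *m _)]scaleN1r.
apply: (@mcvg_near _ _ _ _ _ _ (fun y => (-1) *: (invmx (F y) *m
    (((y - x)^-1)%:C *: (F y - F x)) *m invmx (F x)))); last first.
  apply: (@mcvgZ _ _ _ _ _ _ (fun=> -1)); first exact: ccvg_cst.
  by apply: mcvgM; [exact: mcvgM|exact: mcvg_cst].
rewrite /prop_near1 /nbhs /= /within /=.
apply: nearW => y Dy; rewrite -scalemxAr -scalemxAl scalerA mulrC -scalerA.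
congr (_ *: _); rewrite scaleN1r mulmxBr mulmxBl mulVmx ?FU// mul1mx.
by rewrite -mulmxA mulmxV ?FU// mulmx1 opprB.
Qed.

End MatrixDerivatives.

(** * The matrix exponential *)

Lemma cvg_dnbhs_shift (R : realType) (a c : R) :
  (fun y => y + c) @ a^' --> (a + c)^'.
Proof.
move=> P; rewrite /nbhs /= /dnbhs /within /= => Pac.
have yc : (fun y : R => y + c) @ a --> a + c.
  by apply: cvgD; [exact: cvg_refl|exact: cvg_cst].
have Py : \forall y \near a, y + c != a + c -> P (y + c) := yc _ Pac.
near=> y => ya; apply: (near Py y) => //.
by rewrite (inj_eq (addIr c)).
Unshelve. all: by end_near.
Qed.

(** Gives access to the library results on power series, integrals and mean values. The two
    quotients differ by the substitution h = y - x. *)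
Lemma is_derive_inT (R : realType) (f : R -> R) (x l : R) :
  is_derive_in setT f x l <-> is_derive x 1 f l.
Proof.
pose g (h : R) := h^-1 *: (f (h *: (1 : R) + x) - f x).
have gE y : (f y - f x) / (y - x) = g (y - x).
  by rewrite /g mulrC /GRing.scale /= mulr1 subrK.
rewrite /is_derive_in; have -> : within setT x^' = x^'.
  apply/funext => P; rewrite /within; congr (x^' _).
  by apply/seteqP; split=> y //=; exact.
under eq_fun do rewrite gE.
split=> [gl|[dl <-]].
- suff gl' : g h @[h --> 0^'] --> l.
    by apply: DeriveDef; [apply/cvg_ex; exists l|exact: cvg_lim].
  have -> : g = (fun h => g (h + x - x)) by apply/funext => h; rewrite addrK.
  apply: (@cvg_comp _ _ _ (fun h => h + x) (fun y => g (y - x))) gl.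
  by have := @cvg_dnbhs_shift R 0 x; rewrite add0r.
- apply: (@cvg_comp _ _ _ (fun y => y - x) g) dl.
  by have := @cvg_dnbhs_shift R x (- x); rewrite subrr.
Qed.

Lemma is_derive_pseries (R : realType) (c : R^nat) (x : R) :
  (forall y, cvgn (pseries c y)) ->
  (forall y, cvgn (pseries (pseries_diffs c) y)) ->
  (forall y, cvgn (pseries (pseries_diffs (pseries_diffs c)) y)) ->
  is_derive x 1 (fun y => limn (pseries c y))
    (limn (pseries (pseries_diffs c) x)).
Proof.
(* Termwise differentiation is valid strictly inside a disc of convergence; the radius |x| + 1 puts
   [x] inside. *)
move=> c0 c1 c2; apply: (@pseries_snd_diffs _ c (`|x| + 1)) => //.
by rewrite [`| _ + _ |]ger0_norm ?ltrDl ?addr_ge0.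
Qed.

(** Absolute convergence by comparison with [C] times the series of exp(b |x|). *)
Lemma is_cvg_pseries_exp (R : realType) (c : R^nat) (C b x : R) :
  0 <= b -> (forall k, `|c k| <= C * (b ^+ k / k`!%:R)) -> cvgn (pseries c x).
Proof.
move=> b0 cb; apply: normed_cvg.
(* The bound at k = 0 reads |c 0| <= C. *)
have C0 : 0 <= C.
  have := le_trans (normr_ge0 _) (cb 0%N).
  by rewrite expr0 fact0 divr1 mulr1.
have e0 k : 0 <= exp_coeff (b * `|x|) k.
  by rewrite /exp_coeff/= divr_ge0 ?exprn_ge0 ?mulr_ge0.
apply: (@series_le_cvg _ _ (C *: exp_coeff (b * `|x|))) => [k|k|k|].
- exact: normr_ge0.
- by rewrite /GRing.scale /=; apply: mulr_ge0.
- rewrite [leRHS](_ : _ = C * (b ^+ k / k`!%:R) * `|x| ^+ k).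
    by rewrite /= normrM normrX ler_wpM2r ?exprn_ge0.
  by rewrite /GRing.scale /= /exp_coeff /= exprMn -!mulrA [_^-1 * _]mulrC.
- exact: is_cvg_seriesZ (is_cvg_series_exp_coeff _).
Qed.

Lemma expmxZ (K : comPzRingType) (n : nat) (c : K) (B : 'M[K]_n) (k : nat) :
  (c *: B) ^+ k = c ^+ k *: B ^+ k.
Proof.
elim: k => [|k IH]; first by rewrite !expr0 scale1r.
by rewrite !exprS IH -!mulmxE -scalemxAl -scalemxAr scalerA.
Qed.

Lemma normc_expmx_le (R : realType) (n : nat) (B : 'M[R[i]]_n) (k : nat) i j :
  normc ((B ^+ k) i j) <= (\sum_a \sum_d normc (B a d)) ^+ k.
Proof.
have nn0 (z : R[i]) : 0 <= normc z by case: z => a b; exact: sqrtr_ge0.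
have nD (z w : R[i]) : normc (z + w) <= normc z + normc w.
  exact: le_normcD.
set b := \sum_i _.
have b0 : 0 <= b by apply: sumr_ge0 => a _; apply: sumr_ge0.
elim: k i j => [|k IH] i j.
  rewrite !expr0 mxE; case: eqP => _; last by rewrite mulr0n normc0.
  by rewrite mulr1n normc1.
rewrite !exprS mxE.
apply: (@le_trans _ _ (\sum_l normc (B i l) * b ^+ k)).
  elim/big_rec2 : _ => [|l z w _ zw]; first by rewrite normc0.
  apply: le_trans (nD _ _) _; apply: lerD => //.
  by rewrite normcM ler_wpM2l.
(* The norms in row [i] sum to one of the nonnegative row sums that make up [b]. *)
rewrite -mulr_suml ler_wpM2r ?exprn_ge0// /b [leRHS](bigD1 i)//=.
by rewrite lerDl; apply: sumr_ge0 => a _; apply: sumr_ge0.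
Qed.

Section MatrixExponential.
Context {R : realType} {n : nat} (B : 'M[R[i]]_n).

Let expsum (y : R) (N : nat) : 'M[R[i]]_n :=
  \sum_(k < N) (k`!%:R)^-1 *: (y%:C *: B) ^+ k.

Section Coordinate.
(* [phi] is the real or the imaginary part. *)
Variables (phi : R[i] -> R) (phiD : {morph phi : z w / z + w})
  (phiZ : forall (r : R) z, phi (r%:C * z) = r * phi z)
  (phi_le : forall z, `|phi z| <= normc z) (i j : 'I_n).

(** Power series coefficients, in the real variable y, of one real coordinate of B^m exp(yB). The
    shift [m] counts derivatives: [coord_diffs] shows that termwise differentiation replaces [m] by
    [m.+1]. *)
Let coord (m k : nat) : R := phi ((B ^+ (m + k)) i j) / k`!%:R.

Let coord_diffs m : pseries_diffs (coord m) = coord m.+1.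
Proof.
apply/funext => k; rewrite /pseries_diffs /coord addnS addSn factS natrM.
by rewrite invfM mulrCA mulVKf.
Qed.

Let coord_cvg m (y : R) : cvgn (pseries (coord m) y).
Proof.
set b := \sum_i \sum_j normc (B i j).
apply: (@is_cvg_pseries_exp _ _ (b ^+ m) b) => [|k].
  apply: sumr_ge0 => a _; apply: sumr_ge0 => d _.
  by case: (B a d) => u v; exact: sqrtr_ge0.
rewrite /coord normrM [`|_^-1|]ger0_norm ?invr_ge0// mulrA -exprD.
rewrite ler_wpM2r ?invr_ge0//.
exact: le_trans (phi_le _) (normc_expmx_le _ _ _ _).
Qed.

Let coordE m (y : R) :
  (fun N => phi ((B ^+ m *m expsum y N) i j)) = pseries (coord m) y.
Proof.
have phi0 : phi 0 = 0 by have := phiZ 0 0; rewrite mulr0 mul0r.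
apply/funext => N; rewrite mulmx_sumr summxE /pseries /series /= big_mkord.
rewrite (big_morph _ phiD phi0); apply: eq_bigr => k _.
rewrite expmxZ scalerA -scalemxAr mxE mulmxE -exprD.
(* The scalar must be exhibited as real, since [phi] is only linear over [R]. *)
rewrite (_ : _ * _ ^+ k = (k`!%:R^-1 * y ^+ k)%:C); last first.
  by rewrite rmorphM fmorphV rmorphXn rmorph_nat.
by rewrite phiZ mulrC /coord mulrA.
Qed.

Let coord0E (y : R) : (fun N => phi (expsum y N i j)) = pseries (coord 0) y.
Proof. by rewrite -coordE; apply/funext => N; rewrite expr0 mulmxE mul1r. Qed.

Lemma is_cvg_mxexp_coord (y : R) : cvgn (fun N => phi (expsum y N i j)).
Proof. by rewrite coord0E; exact: coord_cvg. Qed.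

Lemma is_derive_mxexp_coord (x : R) :
  is_derive x 1 (fun y => limn (fun N => phi (expsum y N i j)))
    (limn (fun N => phi ((B *m expsum x N) i j))).
Proof.
under eq_fun do rewrite coord0E.
have := coordE 1 x; rewrite expr1 -coord_diffs => ->.
by apply: is_derive_pseries => y; rewrite ?coord_diffs; exact: coord_cvg.
Qed.

End Coordinate.

Lemma mcvg_mxexp (y : R) : mcvg \oo (expsum y) (mxexp (y%:C *: B)).
Proof.
move=> i j; split; rewrite mxE.
- exact: (is_cvg_mxexp_coord (phi := @complex.Re R) ReD ReZ normRe_le).
- exact: (is_cvg_mxexp_coord (phi := @complex.Im R) ImD ImZ normIm_le).
Qed.

Lemma is_mxderive_mxexp (D : set R) (x : R) :
  is_mxderive_in D (fun y => mxexp (y%:C *: B)) x (B *m mxexp (x%:C *: B)).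
Proof.
apply: (@is_mxderive_sub _ setT) => // i j.
(* The claimed derivative is rewritten as the limit of [B] times the partial sums, the form given by
   [is_derive_mxexp_coord]. *)
have [/cvg_lim <- // /cvg_lim <- //] :=
  mcvgM (mcvg_cst (F := \oo) B) (mcvg_mxexp x) i j.
split; apply/is_derive_inT; under eq_fun do rewrite mxE.
- exact: (is_derive_mxexp_coord (phi := @complex.Re R) ReD ReZ normRe_le).
- exact: (is_derive_mxexp_coord (phi := @complex.Im R) ImD ImZ normIm_le).
Qed.

End MatrixExponential.

Lemma mxexp0 (R : realType) (n : nat) : mxexp (0 : 'M[R[i]]_n) = 1%:M.
Proof.
have := @mcvg_mxexp R n 0 0; rewrite scaler0 => /mcvg_unique; apply.
apply: (@mcvg_near _ _ _ _ _ _ (fun=> 1%:M)); last exact: mcvg_cst.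
(* The empty sum at N = 0 is excluded; from N = 1 on, every partial sum is the identity. *)
exists 1%N => // -[//|N] _.
rewrite big_ord_recl fact0 invr1 scale1r expr0 big1 ?addr0// => k _.
by rewrite exprS mul0r scaler0.
Qed.

(** * Integrals and the mean value theorem on the half-line *)

Lemma is_derive_in_interior (R : realType) (D : set R) (f : R -> R) (x l : R) :
  D° x -> is_derive_in D f x l -> is_derive x 1 f l.
Proof.
move=> Dx fl; apply/is_derive_inT; apply: cvg_trans fl.
apply: cvg_app => P; rewrite /within /nbhs /= /dnbhs /within /= => DP.
have {}DP : \forall y \near x, y != x -> D y -> P y by exact: DP.
have {}Dx : \forall y \near x, D y by exact: Dx.
suff : \forall y \near x, y != x -> setT y -> P y by [].
by near=> y => yx _; apply: (near DP y) => //; near: y.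
Unshelve. all: by end_near. Qed.

Lemma is_derive_in_cvg (R : realType) (D : set R) (f : R -> R) (x l : R) :
  is_derive_in D f x l -> f y @[y --> within D x^'] --> f x.
Proof.
move=> fl; have Dxx : within D x^' --> x.
  by apply: (@cvg_trans _ (x^')); exact: cvg_within.
have -> : f x = f x + (x - x) * l by rewrite subrr mul0r addr0.
apply: (@cvg_trans _ ((fun y => f x + (y - x) * ((f y - f x) / (y - x)))
    @ within D x^')).
  apply: near_eq_cvg; apply: nearW => y; have [->|yx] := eqVneq y x.
    by rewrite !subrr mul0r addr0.
  by rewrite mulrC divfK ?subr_eq0// addrC subrK.
apply: cvgD; first exact: cvg_cst.
by apply: cvgM => //; apply: cvgB; [exact: Dxx|exact: cvg_cst].
Qed.

(** Inside the half-line the relative derivative is the ordinary one. At 0 it still gives right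
    continuity, which is all that the mean value theorem asks of an endpoint. *)
Lemma MVT_halfline (R : realType) (f df : R -> R) (x : R) : 0 <= x ->
  (forall y, 0 <= y -> is_derive_in `[0, +oo[ f y (df y)) ->
  exists2 c, 0 <= c & f x - f 0 = df c * x.
Proof.
rewrite le_eqVlt => /predU1P[<-|x0] fdf.
  (* For x = 0 both sides vanish, so any point serves. *)
  by exists 0; rewrite // subrr mulr0.
have fder (y : R) : 0 < y -> is_derive y 1 f (df y).
  move=> y0; apply: (@is_derive_in_interior _ `[0, +oo[); last exact/fdf/ltW.
  rewrite /interior /=; near=> z; rewrite /= in_itv /= andbT.
  by apply: ltW; near: z; exact: lt_nbhsr.
have fcont (y : R) : 0 < y -> {for y, continuous f}.
  move=> y0; apply: differentiable_continuous; apply/derivable1_diffP.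
  by have [] := fder _ y0.
have [||c] := @MVT _ f df 0 x x0.
- by move=> y; rewrite in_itv /= => /andP[y0 _]; exact: fder.
- apply/continuous_within_itvP => //; split.
  + by move=> y; rewrite in_itv /= => /andP[y0 _]; exact: fcont.
  + apply: cvg_trans (is_derive_in_cvg (fdf 0 (lexx _))).
    apply: cvg_app => P.
    rewrite /at_right /within /nbhs /= /dnbhs /within /= => DP.
    have {}DP : \forall y \near (0 : R),
        y != 0 -> `[0, +oo[%classic y -> P y by exact: DP.
    suff : \forall y \near (0 : R), 0 < y -> P y by [].
    near=> y => y0; apply: (near DP y) => //; first by rewrite gt_eqF.
    by rewrite /= in_itv /= andbT ltW.
  + exact: cvg_at_left_filter (fcont _ x0).
- rewrite in_itv /= => /andP[c0 _]; rewrite subr0 => ->.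
  by exists c => //; exact: ltW.
Unshelve. all: by end_near. Qed.

Lemma is_derive_in_Rintegral (R : realType) (f : R -> R) (x : R) :
  continuous f -> 0 <= x ->
  is_derive_in `[0, +oo[
    (fun y => Rintegral lebesgue_measure `[0, y] f) x (f x).
Proof.
move=> fc x0.
have fi (a b : R) : lebesgue_measure.-integrable `[a, b] (EFin \o f).
  apply: continuous_compact_integrable; first exact: segment_compact.
  by apply: continuous_subspaceT => y; exact: fc.
(* Starting the integral at -1 makes it differentiable on both sides of 0. *)
pose G (y : R) := Rintegral lebesgue_measure `[-1, y] f.
have Gx : is_derive_in setT G x (f x).
  apply/is_derive_inT.
  (* The upper bound x + 1 only makes [x] interior to the interval of integration. *)
  have [||||dG GE] := @continuous_FTC1_closed R f (-1) x (x + 1).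
  - by rewrite ltrDl.
  - exact: fi.
  - by rewrite (lt_le_trans _ x0)// ltrN10.
  - exact: fc.
  by apply: DeriveDef; [exact: dG|rewrite -derive1E; exact: GE].
have GE (y : R) : 0 <= y ->
    G y - G 0 = Rintegral lebesgue_measure `[0, y] f.
  move=> y0; rewrite /G Rintegral_itvB// ?bnd_simp// ?lerN10//.
  (* The difference is the integral over ]0, y]; adding the endpoint 0 does not change it. *)
  rewrite Rintegral_itv_obnd_cbnd//.
  apply: integrableS (fi 0 y) => //; exact: subset_itv_oc_cc.
apply: (@cvg_trans _ ((fun y => (G y - G x) / (y - x)) @
    within `[0, +oo[ x^')).
  apply: near_eq_cvg; rewrite /prop_near1 /nbhs /= /within /=.
  apply: nearW => y; rewrite in_itv /= andbT => y0.
  by rewrite -!GE// opprB addrA subrK.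
by apply: cvg_trans Gx; apply: cvg_app; apply: within_subset.
Unshelve. all: by end_near. Qed.

Lemma is_mxderive_mxintegral (R : realType) (p q : nat)
    (F : R -> 'M[R[i]]_(p, q)) (x : R) :
  (forall y, mcvg (nbhs y) F (F y)) -> 0 <= x ->
  is_mxderive_in `[0, +oo[ (fun y => mxintegral `[0, y] F) x (F x).
Proof.
move=> Fc x0 i j.
pose G (phi : R[i] -> R) (y : R) :=
  Rintegral lebesgue_measure `[0, y] (fun s => phi (F s i j)).
split.
- rewrite (_ : (fun y => _) = G (@complex.Re R)).
    by apply: is_derive_in_Rintegral => // y; exact: (Fc y i j).1.
  by apply/funext => y; rewrite mxE.
- rewrite (_ : (fun y => _) = G (@complex.Im R)).
    by apply: is_derive_in_Rintegral => // y; exact: (Fc y i j).2.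
  by apply/funext => y; rewrite mxE.
Qed.

Lemma is_mxderive_continuous (R : realType) (p q : nat)
    (F : R -> 'M[R[i]]_(p, q)) (x : R) L :
  is_mxderive_in setT F x L -> mcvg (nbhs x) F (F x).
Proof.
move=> FL i j; have [/is_derive_inT fr /is_derive_inT fi] := FL i j.
split.
- by case: fr => /derivable1_diffP/differentiable_continuous.
- by case: fi => /derivable1_diffP/differentiable_continuous.
Qed.

(** Carries identities from 0 to every x >= 0. The mean value theorem is applied to each real and
    imaginary part, with its own intermediate point. *)
Lemma is_mxderive0_cst (R : realType) (p q : nat)
    (F : R -> 'M[R[i]]_(p, q)) (x : R) : 0 <= x ->
  (forall y, 0 <= y -> is_mxderive_in `[0, +oo[ F y 0) -> F x = F 0.
Proof.
move=> x0 F0; apply/matrixP => i j.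
have [_ _ /eqP] := MVT_halfline x0 (fun y y0 => (F0 y y0 i j).1).
have [_ _ /eqP] := MVT_halfline x0 (fun y y0 => (F0 y y0 i j).2).
rewrite mxE /= !mul0r !subr_eq0 => /eqP eqI /eqP eqR.
by apply/eqP; rewrite eq_complex eqI eqR !eqxx.
Qed.

(** * Matrix identities and the functions PiF and SF *)

Section ConjugateTranspose.
Context {C : numClosedFieldType}.

Lemma trCM (p q r : nat) (M : 'M[C]_(p, q)) (N : 'M[C]_(q, r)) :
  (M *m N) ^t* = N ^t* *m M ^t*.
Proof. by rewrite trmx_mul map_mxM. Qed.

Lemma trCD (p q : nat) (M N : 'M[C]_(p, q)) : (M + N) ^t* = M ^t* + N ^t*.
Proof. by rewrite !raddfD. Qed.

Lemma trCB (p q : nat) (M N : 'M[C]_(p, q)) : (M - N) ^t* = M ^t* - N ^t*.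
Proof. by rewrite !raddfB. Qed.

Lemma trCZ (p q : nat) (c : C) (M : 'M[C]_(p, q)) : (c *: M) ^t* = c^* *: M ^t*.
Proof. by rewrite linearZ map_mxZ. Qed.

Lemma trC1 (p : nat) : (1%:M : 'M[C]_p) ^t* = 1%:M.
Proof. by rewrite trmx1 map_mx1. Qed.

Lemma trC_inv (p : nat) (M : 'M[C]_p) : (invmx M) ^t* = invmx (M ^t*).
Proof. by rewrite trmx_inv map_invmx. Qed.

Lemma trC_unit (p : nat) (M : 'M[C]_p) : (M ^t* \in unitmx) = (M \in unitmx).
Proof. by rewrite map_unitmx unitmx_tr. Qed.

Lemma trC_mulmx_ge0 (p : nat) (w : 'cV[C]_p) : 0 <= (w ^t* *m w) 0 0.
Proof.
by rewrite mxE; apply: sumr_ge0 => k _; rewrite !mxE mulrC mul_conjC_ge0.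
Qed.

Lemma trC_mulmx_gt0 (p : nat) (w : 'cV[C]_p) : w != 0 -> 0 < (w ^t* *m w) 0 0.
Proof.
move=> w0; rewrite lt_def trC_mulmx_ge0 andbT; apply: contra_neq w0.
rewrite mxE => /eqP; rewrite psumr_eq0 => [/allP ww|k _]; last first.
  by rewrite !mxE mulrC mul_conjC_ge0.
apply/matrixP => i k; rewrite ord1 mxE.
have := ww i (mem_index_enum i).
by rewrite !mxE mulrC mul_conjC_eq0 => /eqP.
Qed.

End ConjugateTranspose.

(** * Algebra of the Darboux matrix; [c], [A'], [P'] stand for i, A^H, Pi^H *)

Section DarbouxMatrix.
Context {K : comUnitRingType} {n m : nat}.
Variables (c : K) (A A' S : 'M[K]_n) (P : 'M[K]_(n, m)) (P' : 'M[K]_(m, n))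
  (j : 'M[K]_m).
Hypotheses (cc : c * c = -1) (AU : A \in unitmx) (A'U : A' \in unitmx)
  (SU : S \in unitmx) (ASA : A *m S - S *m A' = c *: (P *m j *m P')).

(** The identity [ASA] solved for P j P', using 1/c = -c. It trades that product for a difference in
    which [A], [A'] and [S] cancel against neighbouring inverses. *)
Lemma darboux_intertwine (p : nat) (X : 'M[K]_(p, n)) :
  X *m (P *m j *m P') = - c *: (X *m A *m S - X *m S *m A').
Proof.
rewrite -[X *m A *m S]mulmxA -[X *m S *m A']mulmxA -mulmxBr ASA -scalemxAr.
by rewrite scalerA mulNr cc opprK scale1r.
Qed.

Lemma darboux_mulV :
  (1%:M - c *: (j *m P' *m invmx S *m invmx A *m P)) *m
  (1%:M + c *: (j *m P' *m invmx A' *m invmx S *m P)) = 1%:M.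
Proof.
set X := j *m P' *m invmx S *m invmx A; pose Y := invmx A' *m invmx S *m P.
have -> : j *m P' *m invmx A' *m invmx S *m P = j *m P' *m Y.
  by rewrite /Y !mulmxA.
(* The quadratic term of the product is thus a combination of the two linear terms, and cancels
   them. *)
have XY : X *m P *m (j *m P' *m Y) = - c *: (j *m P' *m Y - X *m P).
  rewrite -[X *m P *m _]mulmxA [P *m _]mulmxA mulmxA [P *m (j *m P')]mulmxA.
  rewrite darboux_intertwine -scalemxAl mulmxBl; congr (_ *: (_ - _)).
    by rewrite /X [_ *m invmx A *m A]mulmxKV// mulmxKV.
  by rewrite /Y -!mulmxA mulKVmx// mulKVmx.
rewrite mulmxBl mul1mx -scalemxAl mulmxDr mulmx1 -scalemxAr XY.
by rewrite scalerA mulrN cc opprK scale1r [X *m P + _]addrC subrK addrK.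
Qed.

(** With [Z] as below, Z P j P' S^-1 = -c (Z A - j P' S^-1); multiplied by [c], it removes j P' S^-1
    and leaves Z A. *)
Lemma darboux_mul :
  (1%:M + c *: (j *m P' *m invmx A' *m invmx S *m P)) *m (j *m P' *m invmx S) =
  j *m P' *m invmx A' *m invmx S *m A.
Proof.
set Z := j *m P' *m invmx A' *m invmx S.
rewrite mulmxDl mul1mx -scalemxAl.
have -> : Z *m P *m (j *m P' *m invmx S) = - c *: (Z *m A - j *m P' *m invmx S).
  rewrite -[Z *m P *m _]mulmxA [P *m _]mulmxA mulmxA [P *m (j *m P')]mulmxA.
  rewrite darboux_intertwine -scalemxAl mulmxBl; congr (_ *: (_ - _)).
    by rewrite mulmxK.
  by rewrite /Z mulmxKV// mulmxKV.
by rewrite scalerA mulrN cc opprK scale1r addrC subrK.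
Qed.
End DarbouxMatrix.

Lemma jmx_sq (R : realType) (m1 m2 : nat) : jmx R m1 m2 *m jmx R m1 m2 = 1%:M.
Proof.
rewrite /jmx mulmx_block !mul0mx !mulmx0 !mul1mx !addr0 add0r mulmxN mulmx1.
by rewrite opprK -scalar_mx_block.
Qed.

Lemma jmx_trC (R : realType) (m1 m2 : nat) : (jmx R m1 m2) ^t* = jmx R m1 m2.
Proof.
rewrite /jmx tr_block_mx map_block_mx !trmx0 !map_mx0.
by rewrite !raddfN /= !trC1.
Qed.

(** * Derivatives of Pi and S, and the properties of S(x) inherited from S(0) *)

Section CanonicalSystem.
Context {R : realType} {n m1 m2 : nat}.
Variables (A S0 : 'M[R[i]]_n) (th1 : 'M[R[i]]_(n, m1)) (th2 : 'M[R[i]]_(n, m2)).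
Local Notation j := (jmx R m1 m2).
Local Notation Pi := (PiF A th1 th2).
Local Notation S := (SF A S0 th1 th2).
Local Notation D := (`[0, +oo[%classic : set R).

Lemma mxexp_iE (B : 'M[R[i]]_n) (x : R) :
  mxexp (('i * x%:C) *: B) = mxexp (x%:C *: ('i *: B)).
Proof. by rewrite scalerA mulrC. Qed.

(** Right multiplication by [j] accounts for the opposite signs of the exponents in the two
    blocks. *)
Lemma PiF_derive (E : set R) (x : R) :
  is_mxderive_in E Pi x (- 'i *: (A *m Pi x *m j)).
Proof.
have mxexp_NiE (y : R) :
    mxexp (- ('i * y%:C) *: A) = mxexp (y%:C *: (- 'i *: A)).
  by rewrite scalerA mulrN mulrC.
have -> : Pi = fun y => row_mx (mxexp (y%:C *: (- 'i *: A)) *m th1)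
    (mxexp (y%:C *: ('i *: A)) *m th2).
  by apply/funext => y; rewrite /PiF mxexp_NiE mxexp_iE.
rewrite /jmx mul_mx_row mul_row_block !mulmx0 addr0 add0r mulmx1 mulmxN mulmx1.
rewrite scale_row_mx scalerN !scaleNr opprK !mulmxA.
rewrite -!scaleNr !scalemxAl.
by apply: is_mxderive_row_mx; apply: is_mxderiveMr; exact: is_mxderive_mxexp.
Qed.

Lemma PiF0 : Pi 0 = row_mx th1 th2.
Proof. by rewrite /PiF mulr0 oppr0 scale0r mxexp0 !mul1mx. Qed.

Lemma PiF_trC_derive (E : set R) (x : R) :
  is_mxderive_in E (fun y => (Pi y) ^t*) x ('i *: (j *m (Pi x) ^t* *m A ^t*)).
Proof.
have /is_mxderive_trC := PiF_derive E x.
by rewrite trCZ rmorphN /= conjCi opprK !trCM jmx_trC mulmxA.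
Qed.

Lemma SF_derive (x : R) : 0 <= x ->
  is_mxderive_in D S x (Pi x *m (Pi x) ^t*).
Proof.
move=> x0; rewrite -[_ *m _]add0r; apply: is_mxderiveD.
  exact: is_mxderive_cst.
apply: (is_mxderive_mxintegral (F := fun s => Pi s *m (Pi s) ^t*)) => // y.
apply: is_mxderive_continuous.
exact: is_mxderiveM (PiF_derive _ _) (PiF_trC_derive _ _).
Qed.

Lemma SF0 : S 0 = S0.
Proof.
rewrite /SF set_itv1 [X in _ + X](_ : _ = 0) ?addr0//.
by apply/matrixP => a b; rewrite !mxE !Rintegral_set1.
Qed.

Section Invariants.
Variable x : R.
Hypotheses (x0 : 0 <= x) (hS0 : posdefmx S0)
  (hid : A *m S0 - S0 *m A ^t* =
         'i *: (row_mx th1 th2 *m j *m (row_mx th1 th2) ^t*)).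

(** S^H - S vanishes at 0 and has zero derivative, because Pi Pi^H is Hermitian. *)
Lemma SF_trC : (S x) ^t* = S x.
Proof.
pose F y := (S y) ^t* - S y.
suff : F x = F 0.
  have S0h : S0 ^t* = S0.
    by have [/is_hermitianmxP] := hS0; rewrite expr0 scale1r.
  by rewrite /F SF0 S0h subrr => /eqP; rewrite subr_eq0 => /eqP.
apply: is_mxderive0_cst => // y y0; rewrite -(subrr (Pi y *m (Pi y) ^t*)).
apply: is_mxderiveB; last exact: SF_derive.
by have /is_mxderive_trC := SF_derive y0; rewrite trCM trmxCK.
Qed.

Lemma SF_identity :
  A *m S x - S x *m A ^t* = 'i *: (Pi x *m j *m (Pi x) ^t*).
Proof.
pose F y := A *m S y - S y *m A ^t* - 'i *: (Pi y *m j *m (Pi y) ^t*).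
suff : F x = F 0.
  by rewrite /F SF0 PiF0 hid subrr => /eqP; rewrite subr_eq0 => /eqP.
apply: is_mxderive0_cst => // y y0.
have dP := PiF_derive D y; have dP' := PiF_trC_derive D y.
have dS := SF_derive y0.
have := is_mxderiveB
  (is_mxderiveB (is_mxderiveMl A dS) (is_mxderiveMr (A ^t*) dS))
  (is_mxderiveZ 'i (is_mxderiveM (is_mxderiveMr j dP) dP')).
(* As j^2 = 1, the derivative of i Pi j Pi^H is A Pi Pi^H - Pi Pi^H A^H, which is also that of A S -
   S A^H. *)
rewrite [X in is_mxderive_in _ _ _ X -> _](_ : _ = 0) //.
rewrite -!scalemxAl -!scalemxAr scalerDr !scalerA mulrN -expr2 sqrCi opprK.
rewrite scale1r scaleN1r !mulmxA.
rewrite -[_ *m j *m j]mulmxA jmx_sq mulmx1.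
by rewrite -[_ *m j *m j]mulmxA jmx_sq mulmx1 subrr.
Qed.

(** If v S(x) = 0 with v nonzero, then v S(y) v^H is positive at y = 0 and zero at y = x, although
    its derivative is nonnegative. *)
Lemma SF_unit : S x \in unitmx.
Proof.
rewrite unitmxE unitfE; apply/negP => /det0P[v v0 vS].
pose F y := v *m S y *m v ^t*.
have dF (y : R) : 0 <= y ->
    is_mxderive_in D F y (v *m (Pi y *m (Pi y) ^t*) *m v ^t*).
  by move=> y0; apply/is_mxderiveMr/is_mxderiveMl/SF_derive.
have [c c0] := MVT_halfline x0 (fun y y0 => (dF y y0 0 0).1).
have : 0 < complex.Re (F 0 0 0).
  have := hS0.2 (v ^t*); rewrite trmxCK /F SF0.
  have -> : v ^t* != 0.
    by apply: contra_neq v0 => v0; rewrite -[v]trmxCK v0 trmx0 map_mx0.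
  by move=> /(_ isT); rewrite ltcE => /andP[_].
(* This is the squared norm of the column (v Pi(c))^H. *)
have : 0 <= complex.Re ((v *m (Pi c *m (Pi c) ^t*) *m v ^t*) 0 0).
  rewrite mulmxA -mulmxA -trCM -{1}[v *m _]trmxCK.
  by have := trC_mulmx_ge0 ((v *m Pi c) ^t*); rewrite lecE => /andP[_].
move=> d0 F0; rewrite {1}/F vS mul0mx mxE /= sub0r => F0E.
by have := mulr_ge0 d0 x0; rewrite -F0E oppr_ge0 leNgt F0.
Qed.

End Invariants.
End CanonicalSystem.

(** * The canonical system *)

(** The quadratic form at v is the squared norm of M^H v, nonzero for v nonzero since M^H is
    invertible. *)
Lemma posdefmx_mul_trC (R : realType) (p : nat) (M : 'M[R[i]]_p) :
  M \in unitmx -> posdefmx (M *m M ^t*).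
Proof.
move=> MU; split.
  by apply/is_hermitianmxP; rewrite expr0 scale1r trCM trmxCK.
move=> v v0; rewrite mulmxA -mulmxA -{1}[M]trmxCK -trCM.
apply: trC_mulmx_gt0; apply: contra_neq v0 => Mv.
by rewrite -[v](mulKmx (_ : M ^t* \in unitmx)) ?trC_unit// Mv mulmx0.
Qed.

(** * Algebra of the product H Y and of its derivative; [T] stands for S^-1 *)

Section CanonicalAlgebra.
Context {K : comUnitRingType} {n m p : nat}.
Variables (c : K) (A A' T : 'M[K]_n) (P : 'M[K]_(n, m)) (P' : 'M[K]_(m, n))
  (j U U' V W : 'M[K]_m) (E : 'M[K]_(n, p)).

Lemma canonical_mul Z : U' \in unitmx -> invmx U = V *m W ->
  W *m (j *m P' *m T) = Z ->
  invmx U *m invmx U' *m (U' *m j *m P' *m T *m E) = V *m Z *m E.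
Proof.
by move=> U'U -> <-; rewrite -!mulmxA mulKmx.
Qed.

Lemma signature_conj : j *m j = 1%:M ->
  j *m (1%:M - c *: (j *m P' *m T *m A *m P)) *m j =
  1%:M - c *: (P' *m T *m A *m P *m j).
Proof.
move=> jj; rewrite mulmxBr mulmx1 mulmxBl jj -scalemxAr -scalemxAl !mulmxA.
by rewrite jj mul1mx.
Qed.

(** The left side is what the product and inverse rules deliver. It is applied with V(0) for [V],
    V(x)^H for [U'] and the exponential for [E], so that j V j U' becomes W(0)^H V(x)^H = u(x)^H. *)
Lemma canonical_derive : c * c = -1 -> A' \in unitmx -> j *m j = 1%:M ->
  U' = (1%:M + c *: (P' *m invmx A' *m T *m P *m j)) ->
  V *m ((j *m (c *: (j *m P' *m A')) *m invmx A' *m T +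
         j *m P' *m invmx A' *m (- (T *m (P *m P') *m T))) *m A) *m E =
  j *m (j *m V *m j *m U' *m j *m P' *m T *m ((c *: A) *m E)).
Proof.
move=> cc A'U jj ->.
(* In the first term [A'] cancels; in the second, -1 is written as c^2. Both then share the factor
   c, and j^2 = 1 brings out [U']. *)
have -> : j *m (c *: (j *m P' *m A')) *m invmx A' *m T +
    j *m P' *m invmx A' *m (- (T *m (P *m P') *m T)) =
  c *: (j *m ((1%:M + c *: (P' *m invmx A' *m T *m P *m j)) *m j *m P' *m T)).
  rewrite -scalemxAr -!scalemxAl [j *m (j *m P' *m A')]mulmxA mulmxK//.
  rewrite !mulmxDl mul1mx mulmxDr scalerDr -!scalemxAl -scalemxAr scalerA cc.
  rewrite scaleN1r mulmxN -!mulmxA; congr (_ - _).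
  by rewrite [j *m (j *m (P' *m T))]mulmxA jj mul1mx.
rewrite -!scalemxAl -!scalemxAr -!scalemxAl; congr (_ *: _).
by rewrite !mulmxA jj mul1mx.
Qed.

End CanonicalAlgebra.

(** * The factorization u(x) = V(x) W(0) and its consequences for H and Y *)

Section TransferMatrix.
Context {R : realType} {n m1 m2 : nat}.
Variables (A S0 : 'M[R[i]]_n) (th1 : 'M[R[i]]_(n, m1)) (th2 : 'M[R[i]]_(n, m2)).
Local Notation j := (jmx R m1 m2).
Local Notation Pi := (PiF A th1 th2).
Local Notation S := (SF A S0 th1 th2).
Local Notation u := (uF A S0 th1 th2).
Local Notation D := (`[0, +oo[%classic : set R).
Hypotheses (hS0 : posdefmx S0) (hA : \det A != 0)
  (hid : A *m S0 - S0 *m A ^t* =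
         'i *: (row_mx th1 th2 *m j *m (row_mx th1 th2) ^t*)).

Let V x := 1%:M - 'i *: (j *m (Pi x) ^t* *m invmx (S x) *m invmx A *m Pi x).
Let W x :=
  1%:M + 'i *: (j *m (Pi x) ^t* *m invmx (A ^t*) *m invmx (S x) *m Pi x).

Let ii : 'i * 'i = -1 :> R[i].
Proof. by rewrite -expr2 sqrCi. Qed.

Let AU : A \in unitmx.
Proof. by rewrite unitmxE unitfE. Qed.

Let AtU : A ^t* \in unitmx.
Proof. by rewrite trC_unit. Qed.

Let VW (x : R) : 0 <= x -> V x *m W x = 1%:M.
Proof.
move=> x0.
exact: (darboux_mulV ii AU AtU (SF_unit A th1 th2 x0 hS0) (SF_identity x0 hid)).
Qed.

Let uE (x : R) : u x = V x *m W 0.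
Proof. by rewrite /uF /V /W PiF0 SF0 trC_inv. Qed.

Let uV (x : R) : 0 <= x -> u x *m (V 0 *m W x) = 1%:M.
Proof.
move=> x0; rewrite uE mulmxA -[_ *m W 0 *m V 0]mulmxA.
(* For square matrices V(0) W(0) = 1 also gives W(0) V(0) = 1, so the middle of V(x) W(0) V(0) W(x)
   disappears. *)
by rewrite (mulmx1C (VW (lexx _))) mulmx1 VW.
Qed.

Lemma uF_unit (x : R) : 0 <= x -> u x \in unitmx.
Proof. by move=> x0; have [ux _] := mulmx1_unit (uV x0). Qed.

Let invu (x : R) : 0 <= x -> invmx (u x) = V 0 *m W x.
Proof.
by move=> x0; rewrite -[RHS]mul1mx -(mulVmx (uF_unit x0)) -mulmxA uV ?mulmx1.
Qed.

Lemma HF_posdef (x : R) : 0 <= x -> posdefmx (HF A S0 th1 th2 x).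
Proof.
move=> x0; rewrite /HF -trC_inv; apply: posdefmx_mul_trC.
by rewrite unitmx_inv uF_unit.
Qed.

Lemma HF_YF (x t : R) : 0 <= x ->
  HF A S0 th1 th2 x *m YF A S0 th1 th2 x t =
  V 0 *m (j *m (Pi x) ^t* *m invmx (A ^t*) *m invmx (S x) *m A) *m
  mxexp (('i * t%:C) *: A).
Proof.
move=> x0; apply: canonical_mul.
- by rewrite trC_unit uF_unit.
- exact: invu.
- exact: (darboux_mul ii AtU (SF_unit A th1 th2 x0 hS0) (SF_identity x0 hid)).
Qed.

(** Since S(0) is Hermitian, conjugate transposition turns j Pi^H A^-H S^-1 Pi into Pi^H S^-1 A^-1
    Pi j; conjugation by [j] then moves [j] to the front. *)
Let V0E : (W 0) ^t* = j *m V 0 *m j.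
Proof.
rewrite /W /V trCD trC1 trCZ conjCi !trCM !trC_inv !trmxCK jmx_trC SF_trC//.
by rewrite (signature_conj _ _ _ _ _ (jmx_sq R m1 m2)) scaleNr !mulmxA.
Qed.

Let VtE (x : R) : 0 <= x -> (V x) ^t* =
  1%:M + 'i *: ((Pi x) ^t* *m invmx (A ^t*) *m invmx (S x) *m Pi x *m j).
Proof.
move=> x0; rewrite /V trCB trC1 trCZ conjCi !trCM !trC_inv !trmxCK jmx_trC.
by rewrite SF_trC// scaleNr opprK !mulmxA.
Qed.

Lemma YF_derive_t (x t : R) : is_mxderive_in setT (YF A S0 th1 th2 x) t
  ((u x) ^t* *m j *m (Pi x) ^t* *m invmx (S x) *m
     (('i *: A) *m mxexp (('i * t%:C) *: A))).
Proof.
have -> : YF A S0 th1 th2 x = fun s => (u x) ^t* *m j *m (Pi x) ^t* *m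
    invmx (S x) *m mxexp (s%:C *: ('i *: A)).
  by apply/funext => s; rewrite /YF mxexp_iE.
by rewrite mxexp_iE; apply: is_mxderiveMl; exact: is_mxderive_mxexp.
Qed.

Lemma HF_YF_derive_x (x t : R) : 0 <= x ->
  is_mxderive_in D (fun y => HF A S0 th1 th2 y *m YF A S0 th1 th2 y t) x
    (j *m ((u x) ^t* *m j *m (Pi x) ^t* *m invmx (S x) *m
      (('i *: A) *m mxexp (('i * t%:C) *: A)))).
Proof.
move=> x0; have Dx : D x by rewrite /= in_itv /= x0.
(* The formula of [HF_YF] is known for y >= 0 only, which suffices for a derivative relative to
   [D]. *)
apply: (@is_mxderive_congr _ _ _ _ (fun y => V 0 *m (j *m (Pi y) ^t* *m
    invmx (A ^t*) *m invmx (S y) *m A) *m mxexp (('i * t%:C) *: A))) => //.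
  by move=> y; rewrite /= in_itv /= andbT => y0; rewrite HF_YF.
have SU y : D y -> S y \in unitmx.
  by rewrite /= in_itv /= andbT => y0; exact: SF_unit.
have dS' := is_mxderive_invmx Dx SU (SF_derive _ _ _ _ x0).
have dP' := is_mxderiveMr (invmx (A ^t*))
  (is_mxderiveMl j (PiF_trC_derive A th1 th2 D x)).
have := is_mxderiveMr (mxexp (('i * t%:C) *: A)) (is_mxderiveMl (V 0)
  (is_mxderiveMr A (is_mxderiveM dP' dS'))).
rewrite (canonical_derive _ _ _ ii AtU (jmx_sq _ _ _) (VtE x0)).
by rewrite -V0E -[(W 0) ^t* *m _]trCM -uE.
Qed.
End TransferMatrix.

Unset Implicit Arguments.

Theorem corollary2p3 (R : realType) (n m1 m2 : nat)
    (A S0 : 'M[R[i]]_n)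
    (th1 : 'M[R[i]]_(n, m1)) (th2 : 'M[R[i]]_(n, m2))
    (hm1 : (0 < m1)%N) (hm2 : (0 < m2)%N)
    (hS0 : posdefmx S0) (hA : \det A != 0)
    (hid : A *m S0 - S0 *m A ^t* =
           'i *: (row_mx th1 th2 *m jmx R m1 m2 *m (row_mx th1 th2) ^t*)) :
  (forall x t : R, 0 <= x ->
     exists dtY dxHY : 'M[R[i]]_(m1 + m2, n),
       [/\ is_mxderive_in setT (fun s => YF A S0 th1 th2 x s) t dtY,
           is_mxderive_in `[0, +oo[
             (fun y => HF A S0 th1 th2 y *m YF A S0 th1 th2 y t) x dxHY
         & dtY = jmx R m1 m2 *m dxHY]) /\
  (forall x : R, 0 <= x -> posdefmx (HF A S0 th1 th2 x)).
Proof.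
split=> [x t x0|x x0]; last exact: HF_posdef.
pose dtY := (uF A S0 th1 th2 x) ^t* *m jmx R m1 m2 *m (PiF A th1 th2 x) ^t* *m
  invmx (SF A S0 th1 th2 x) *m (('i *: A) *m mxexp (('i * t%:C) *: A)).
(* As j^2 = 1, the required equation [dtY] = j [dxHY] forces [dxHY] = j [dtY]. *)
exists dtY, (jmx R m1 m2 *m dtY); split.
- exact: YF_derive_t.
- exact: HF_YF_derive_x.
- by rewrite mulmxA jmx_sq mul1mx.
Qed.
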